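(* For Case A with $\ell$ particles and partitions $\lambda,\nu$ with at most $\ell$ parts, $\mathsf{P}_{\le,n}(\lambda\mid\nu)=\boldsymbol{\pi}^{\lambda/\nu}\prod_{i=1}^{\ell}\prod_{j=1}^n(1-\pi_ix_j)\cdot\det\bigl[h_{\lambda_i-\nu_j+j-i}\bigl(\mathbf{x}_n\sqcup\boldsymbol{\pi}_i^{-1}/\boldsymbol{\pi}_{j-1}^{-1}\bigr)\bigr]_{i,j=1}^{\ell}$.
   Context: Case A particle system: $\ell$ particles labelled $1,\dots,\ell$ on $\mathbb{Z}_{\ge0}$; $G(j,i)$ is the position of particle $j$ after time step $i$, with $G(1,i)\ge\dots\ge G(\ell,i)\ge0$, so configurations are partitions with at most $\ell$ parts. With parameters $x_1,x_2,\dots$ and $\pi_1,\dots,\pi_\ell$ ($\pi_jx_i\in(0,1)$), at each time step $i$ independent $w_{ji}$ with $\mathsf{P}(w_{ji}=k)=(1-\pi_jx_i)(\pi_jx_i)^k$, $k\ge0$, are drawn, and $G(j,i)=\max(G(j,i-1),G(j+1,i))+w_{ji}$ with $G(\ell+1,i)=0$ (geometric jumps, pushing, updated in order $\ell,\dots,1$). Define $\mathsf{P}_{\le,n}(\lambda\mid\nu)=\mathsf{P}(G(\ell,n)\le\lambda_\ell,\dots,G(1,n)\le\lambda_1\mid G(\cdot,0)=\nu)$. Notation: $\boldsymbol{\pi}^{\lambda/\nu}=\prod_j\pi_j^{\lambda_j-\nu_j}$; $\mathbf{x}_n=(x_1,\dots,x_n)$; $\boldsymbol{\pi}_i^{-1}=(\pi_1^{-1},\dots,\pi_i^{-1})$.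 For alphabets $\mathbf{a},\mathbf{b}$, the supersymmetric complete homogeneous function is $h_m(\mathbf{a}/\mathbf{b})=\sum_{k=0}^m(-1)^{m-k}h_k(\mathbf{a})e_{m-k}(\mathbf{b})$ for $m\ge0$ and $0$ for $m<0$; $\mathbf{a}\sqcup\mathbf{a}'$ denotes the union of alphabets. *)

(* Defs.v *)
From HB Require Import structures.
From mathcomp Require Export all_boot all_order all_algebra.
From mathcomp Require Export all_classical all_reals all_analysis.

Set Implicit Arguments.
Unset Strict Implicit.
Unset Printing Implicit Defensive.

Import Order.TTheory GRing.Theory Num.Theory.
Local Open Scope classical_set_scope.
Local Open Scope ring_scope.

(* Particles and parameters are indexed from 0: for j : 'I_l and i : nat, [p j],
   [x i], [w j i] stand for pi_{j+1}, x_{i+1}, w_{j+1,i+1}.  Time is not shifted: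
   [tnth (G i t) j] is G(j+1, i), and [w j i] is used in the step from time i to
   time i+1. *)

Section SymmetricFunctions.
Variable R : comNzRingType.
Implicit Types a b : seq R.

Definition complete_homogeneous (k : nat) a : R :=
  \sum_(s : k.-tuple 'I_(size a) | sorted leq [seq val i | i <- s])
    \prod_(i <- s) a`_i.

Definition elementary (k : nat) b : R :=
  \sum_(s : k.-tuple 'I_(size b) | sorted ltn [seq val i | i <- s])
    \prod_(i <- s) b`_i.

Definition super_homogeneous (m : int) a b : R :=
  match m with
  | Posz m =>
      \sum_(k < m.+1)
        (-1) ^+ (m - k) * complete_homogeneous k a * elementary (m - k) b
  | Negz _ => 0
  end.

End SymmetricFunctions.

(* Partitions with at most l parts, padded with zeros to length l. *)
Definition is_partition (l : nat) (la : l.-tuple nat) : bool := sorted geq la.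

Section Probability.
Context {d : measure_display} {T : measurableType d} {R : realType}.
Variable P : probability T R.

Definition cond_prob (A B : set T) : R := fine (P (A `&` B)) / fine (P B).

Definition mutually_independent (I : eqType) (E : I -> set (set T)) : Prop :=
  forall (s : seq I) (A : I -> set T),
    uniq s -> (forall i, i \in s -> E i (A i)) ->
    P (\bigcap_(i in [set` s]) A i) = (\prod_(i <- s) P (A i))%E.

Definition events_of (U : Type) (X : T -> U) : set (set T) :=
  [set A | exists B : set U, A = X @^-1` B].

Section CaseA.
Variables (l : nat) (p : 'I_l -> R) (x : nat -> R).

(* The events attached to the initial configuration ([None]) and to each
   [w j i]. *)
Definition caseA_events (w : 'I_l -> nat -> T -> nat)
    (G : nat -> T -> l.-tuple nat) (o : option ('I_l * nat)) : set (set T) :=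
  match o with
  | None => events_of (G 0%N)
  | Some (j, i) => events_of (w j i)
  end.

(* In [caseA_step], [nth 0 (G i.+1 t) j.+1] is 0 when [j] is the last particle,
   which is the convention G(l+1, i) = 0. *)
Record caseA_system (w : 'I_l -> nat -> T -> nat)
    (G : nat -> T -> l.-tuple nat) : Prop := CaseASystem {
  caseA_init_measurable :
    forall nu : l.-tuple nat, measurable (G 0%N @^-1` [set nu]);
  caseA_init_partition : forall t, is_partition (G 0%N t);
  caseA_jump_measurable :
    forall j i k, measurable (w j i @^-1` [set k]);
  caseA_jump_law : forall j i k,
    P (w j i @^-1` [set k]) = ((1 - p j * x i) * (p j * x i) ^+ k)%:E;
  caseA_independent : mutually_independent (caseA_events w G);
  caseA_step : forall i t (j : 'I_l),
    tnth (G i.+1 t) j =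
      (maxn (tnth (G i t) j) (nth 0%N (G i.+1 t) j.+1) + w j i t)%N
}.

(* P_{<=,n}(la | nu) *)
Definition prob_le (G : nat -> T -> l.-tuple nat) (n : nat)
    (la nu : l.-tuple nat) : R :=
  cond_prob [set t | forall j : 'I_l, (tnth (G n t) j <= tnth la j)%N]
            [set t | G 0%N t = nu].

End CaseA.
End Probability.

Section Formula.
Variables (R : realType) (l : nat) (p : 'I_l -> R) (x : nat -> R).

(* (x_1, ..., x_n) *)
Definition x_alphabet (n : nat) : seq R := [seq x i | i <- iota 0 n].

(* (pi_1^-1, ..., pi_i^-1) *)
Definition pinv_alphabet (i : nat) : seq R :=
  [seq (p k)^-1 | k : 'I_l <- enum 'I_l & (k < i)%N].

Definition pi_skew (la nu : l.-tuple nat) : R :=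
  \prod_(j < l) p j ^ ((tnth la j)%:Z - (tnth nu j)%:Z).

(* Rows and columns are 0-based: row i is the row i+1 of the matrix, so its
   alphabet is [pinv_alphabet i.+1], and column j carries pi_{(j+1)-1}^-1. *)
Definition caseA_matrix (n : nat) (la nu : l.-tuple nat) : 'M[R]_l :=
  \matrix_(i < l, j < l)
    super_homogeneous
      ((tnth la i)%:Z - (tnth nu j)%:Z + (j : nat)%:Z - (i : nat)%:Z)
      (x_alphabet n ++ pinv_alphabet i.+1) (pinv_alphabet j).

End Formula.

(* Main.v *)
Require Import Defs.
From mathcomp Require Import all_boot all_order all_algebra.
From mathcomp Require Import all_classical all_reals all_analysis.
From mathcomp Require Import perm ring zify.

Set Implicit Arguments.
Unset Strict Implicit.
Unset Printing Implicit Defensive.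

Import Order.TTheory GRing.Theory Num.Theory.
Local Open Scope classical_set_scope.
Local Open Scope ring_scope.

(* Move the particles one at a time, and let F_j be the joint distribution
   function, at integer thresholds la, when exactly the particles i >= j have
   made step n+1.  With q = pi_j x_{n+1}, the geometric jump of particle j gives
   F_j(la) = (1 - q) F_{j+1}(la) + q F_j(la - e_j) for weakly decreasing la: the
   push by particle j+1 is invisible because its threshold is at most la_j.
   Subtracting e_j may create la_j = la_{j+1} - 1; the order of the particles
   then allows to lower la_{j+1} by one as well.  The determinant in which row i
   uses the x-variables consumed by particle i obeys the same two rules: the
   first is h_m(a u y) = h_m(a) + y h_{m-1}(a u y) with y = x_{n+1} in row j, and
   the second is the same identity with y = 1/pi_{j+1}, up to a determinant with
   two equal rows.  At time 0 the determinant is triangular, or has a large zero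
   block, according to whether nu is contained in la. *)

(** * Symmetric functions as generating series *)

Section MulLin.
Variable R : comNzRingType.
Implicit Types (a b : seq R) (f g : nat -> R).

(* Sequences stand for formal power series: [mul_lin y f] is (1 - y z) f(z). *)
Definition mul_lin (y : R) f (k : nat) : R :=
  f k - y * (if k is k'.+1 then f k' else 0).

Definition mul_lins b f : nat -> R := foldr mul_lin f b.

Definition series1 (k : nat) : R := (k == 0)%:R.

Lemma eq_mul_lin y f g : f =1 g -> mul_lin y f =1 mul_lin y g.
Proof. by move=> fg [|k]; rewrite /mul_lin !fg. Qed.

Lemma eq_mul_lins b f g : f =1 g -> mul_lins b f =1 mul_lins b g.
Proof. by move=> fg; elim: b => //= y b IH; exact: eq_mul_lin. Qed.

Lemma mul_linC y z f : mul_lin y (mul_lin z f) =1 mul_lin z (mul_lin y f).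
Proof. by case=> [|[|k]]; rewrite /mul_lin; ring. Qed.

Lemma mul_lins_linC b y f : mul_lins b (mul_lin y f) =1 mul_lin y (mul_lins b f).
Proof.
elim: b => //= z b IH k.
by rewrite (eq_mul_lin z IH) mul_linC.
Qed.

Lemma mul_lins_cat a b f : mul_lins (a ++ b) f = mul_lins a (mul_lins b f).
Proof. by rewrite /mul_lins foldr_cat. Qed.

(** The factor [1 - y z] has constant term 1, so the coefficients are recovered one after the
    other. *)
Lemma mul_lin_inj y f g : mul_lin y f =1 mul_lin y g -> f =1 g.
Proof.
move=> fg; elim=> [|k IH]; first by have := fg 0; rewrite /mul_lin !mulr0 !subr0.
by have := fg k.+1; rewrite /mul_lin IH => /addIr.
Qed.

Lemma mul_lins_inj b f g : mul_lins b f =1 mul_lins b g -> f =1 g.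
Proof. by elim: b => //= y b IH /mul_lin_inj. Qed.

(** A product of [size b] linear factors has degree at most [size b]. *)
Lemma mul_lins1_gt b k : (size b < k)%N -> mul_lins b series1 k = 0.
Proof.
elim: b k => [|y b IH] [|k] //= bk.
by rewrite /mul_lin !IH ?mulr0 ?subr0// ltnW.
Qed.

End MulLin.

Section SymmetricSeries.
Variable R : comNzRingType.
Implicit Types (a b : seq R).

(* [chain 0] describes weakly and [chain 1] strictly increasing sequences with
   entries at least [lo]. *)
Fixpoint chain (s : nat) (lo : nat) (t : seq nat) : bool :=
  if t is i :: t' then (lo <= i)%N && chain s (i + s) t' else true.

Lemma path_leqE i t : path leq i t = chain 0 i t.
Proof. by elim: t i => //= j t IH i; rewrite IH addn0. Qed.

Lemma path_ltnE i t : path ltn i t = chain 1 i.+1 t.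
Proof. by elim: t i => //= j t IH i; rewrite IH addn1. Qed.

Lemma sorted_leqE t : sorted leq t = chain 0 0 t.
Proof. by case: t => //= i t; rewrite path_leqE addn0. Qed.

Lemma sorted_ltnE t : sorted ltn t = chain 1 0 t.
Proof. by case: t => //= i t; rewrite path_ltnE addn1. Qed.

(** For [s = 0] and [s = 1] these are h_k and e_k of [a] without its first [lo] letters. Moving [lo]
    while [a] stays fixed keeps a single index type. *)
Definition chain_sum (s : nat) a (k lo : nat) : R :=
  \sum_(t : k.-tuple 'I_(size a) | chain s lo [seq val i | i <- t])
    \prod_(i <- t) a`_i.

Lemma chain_sum0 s a lo : chain_sum s a 0 lo = 1.
Proof.
rewrite /chain_sum (big_pred1 [tuple]); first by rewrite big_nil.
by move=> t; rewrite tuple0 /= eqxx.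
Qed.

Lemma chain_sumS s a k lo : chain_sum s a k.+1 lo =
  \sum_(i : 'I_(size a) | (lo <= i)%N) a`_i * chain_sum s a k (i + s).
Proof.
rewrite /chain_sum.
rewrite (reindex (fun u : 'I_(size a) * k.-tuple 'I_(size a) =>
  [tuple of u.1 :: u.2])) /=; last first.
  exists (fun t : k.+1.-tuple 'I_(size a) => (thead t, [tuple of behead t])).
    by move=> [i t] _ /=; congr pair; apply/val_inj.
  by move=> t _; rewrite -tuple_eta.
under [RHS]eq_bigr do rewrite big_distrr.
rewrite pair_big_dep /=.
by apply: eq_bigr => -[i t] _; rewrite big_cons.
Qed.

(** The smallest index is either [lo] or larger. *)
Lemma chain_sum_step s a k lo : (lo < size a)%N ->
  chain_sum s a k.+1 lo =
    a`_lo * chain_sum s a k (lo + s) + chain_sum s a k.+1 lo.+1.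
Proof.
move=> lo_a; rewrite !chain_sumS (bigD1 (Ordinal lo_a))//=; congr (_ + _).
by apply: eq_bigl => i; rewrite -val_eqE /=; lia.
Qed.

Lemma chain_sum_end s a k : chain_sum s a k (size a) = (k == 0%N)%:R.
Proof.
case: k => [|k]; first by rewrite chain_sum0.
rewrite chain_sumS big1// => i; have := ltn_ord i; lia.
Qed.

Lemma complete_homogeneousE k a : complete_homogeneous k a = chain_sum 0 a k 0.
Proof. by apply: eq_bigl => t; rewrite sorted_leqE. Qed.

Lemma elementaryE k a : elementary k a = chain_sum 1 a k 0.
Proof. by apply: eq_bigl => t; rewrite sorted_ltnE. Qed.

(** The series of the h_k is inverse to the product of the [1 - y z]: by [chain_sum_step] each
    factor strips one letter. *)
Lemma mul_lins_complete a :
  mul_lins a (fun k => complete_homogeneous k a) =1 series1 R.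
Proof.
have step lo : (lo < size a)%N ->
    mul_lin a`_lo (fun k => chain_sum 0 a k lo) =1 (fun k => chain_sum 0 a k lo.+1).
  move=> lo_a [|k]; rewrite /mul_lin; first by rewrite !chain_sum0 mulr0 subr0.
  by rewrite chain_sum_step// addn0; ring.
have main m : (m <= size a)%N ->
    mul_lins (take m a) (fun k => chain_sum 0 a k 0%N) =1
    (fun k => chain_sum 0 a k m).
  elim: m => [|m IH] ma k; first by rewrite take0.
  rewrite (take_nth 0 ma) -cats1 mul_lins_cat /= mul_lins_linC.
  by rewrite -step//; apply: eq_mul_lin; apply: IH; exact: ltnW.
move=> k; rewrite -[series1 R k]/((k == 0%N)%:R) -(chain_sum_end 0 a) -main//.
rewrite take_size; apply: eq_mul_lins => j.
exact: complete_homogeneousE.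
Qed.

(** The signed e_k are the coefficients of the product of the [1 - y z]; the factors are collected
    from the last letter backwards. *)
Lemma mul_lins_elementary b (f : nat -> R) m :
  \sum_(k < m.+1) (-1) ^+ (m - k) * f k * elementary (m - k) b = mul_lins b f m.
Proof.
under eq_bigr do rewrite elementaryE.
pose conv lo n := \sum_(k < n.+1) (-1) ^+ (n - k) * f k * chain_sum 1 b (n - k) lo.
suff main e lo : (lo + e = size b)%N -> conv lo =1 mul_lins (drop lo b) f.
  by rewrite -[LHS]/(conv 0%N m) (main (size b)) ?drop0.
elim: e lo => [|e IH] lo lob n.
  have -> : lo = size b by lia.
  rewrite drop_size /= /conv big_ord_recr /= subnn chain_sum_end mulr1 mul1r.
  rewrite big1 ?add0r// => k _; rewrite chain_sum_end.
  have /negPf -> : (n - k != 0)%N by have := ltn_ord k; lia.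
  by rewrite mulr0.
have lo_b : (lo < size b)%N by lia.
rewrite (drop_nth 0 lo_b) /= -(eq_mul_lin _ (IH lo.+1 _)); last by lia.
rewrite /conv /mul_lin big_ord_recr [in RHS]big_ord_recr /= !subnn !chain_sum0.
case: n => [|n]; first by rewrite !big_ord0; ring.
rewrite mulr_sumr addrAC -sumrB; congr (_ + _); apply: eq_bigr => k _.
have kn : (k <= n)%N by rewrite -ltnS.
rewrite subSn// chain_sum_step// addn1 exprS; ring.
Qed.

Lemma super_homogeneousE a b m :
  super_homogeneous (Posz m) a b = mul_lins b (fun k => complete_homogeneous k a) m.
Proof. exact: (mul_lins_elementary b (fun k => complete_homogeneous k a)). Qed.

Lemma super_homogeneous_neg a b m : m < 0 -> super_homogeneous m a b = 0.
Proof. by case: m. Qed.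

(** Multiplication by the factors of [a ++ c] turns both sides into 1, and it is injective. *)
Lemma complete_insert a c y :
  mul_lin y (fun k => complete_homogeneous k (a ++ y :: c)) =1
  (fun k => complete_homogeneous k (a ++ c)).
Proof.
apply: (@mul_lins_inj _ (a ++ c)) => k.
rewrite mul_lins_complete mul_lins_cat.
rewrite (eq_mul_lins _ (mul_lins_linC _ _ _)).
by rewrite -[mul_lin y _]/(mul_lins (y :: c) _) -mul_lins_cat mul_lins_complete.
Qed.

(** This is [complete_insert] times the factors of [b], read off in degree [m]; the value 0 in
    negative degrees covers [m <= 0]. Both rules for the determinant are instances. *)
Lemma super_homogeneous_insert m a c b y :
  super_homogeneous m (a ++ y :: c) b =
    super_homogeneous m (a ++ c) b + y * super_homogeneous (m - 1) (a ++ y :: c) b.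
Proof.
case: m => [m|m]; last first.
  have m1 : Negz m - 1 < 0 by lia.
  by rewrite (super_homogeneous_neg _ _ m1) mulr0 addr0.
have : super_homogeneous m (a ++ c) b =
    mul_lin y (mul_lins b (fun k => complete_homogeneous k (a ++ y :: c))) m.
  rewrite super_homogeneousE -mul_lins_linC.
  by apply: eq_mul_lins => k; rewrite complete_insert.
case: m => [|m] ->; rewrite /mul_lin.
  rewrite super_homogeneousE (super_homogeneous_neg _ _ (m := 0 - 1))//; ring.
have -> : m.+1%:Z - 1 = m by lia.
by rewrite !super_homogeneousE; ring.
Qed.

(** Without numerator letters the generating series is a polynomial of degree at most [size b]. *)
Lemma super_homogeneous_nil m b : (size b)%:Z < m -> super_homogeneous m [::] b = 0.
Proof.
case: m => [m|m]; last by rewrite super_homogeneous_neg.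
move=> bm; rewrite super_homogeneousE -[RHS](@mul_lins1_gt _ b m); last by lia.
by apply: eq_mul_lins => k; rewrite -(mul_lins_complete [::]).
Qed.

(** Common factors cancel in the quotient of generating series. *)
Lemma super_homogeneous_cancel m a b c :
  super_homogeneous m (a ++ c) (a ++ b) = super_homogeneous m c b.
Proof.
case: m => [m|m] //; rewrite !super_homogeneousE.
elim: a => //= y a IH.
rewrite -mul_lins_linC -IH; apply: eq_mul_lins.
exact: (complete_insert [::]).
Qed.

Lemma super_homogeneous1 (m : nat) (y : R) :
  super_homogeneous m [:: y] [::] = y ^+ m.
Proof.
elim: m => [|m IH].
  rewrite super_homogeneousE /= complete_homogeneousE.
  by rewrite chain_sum0.
rewrite (super_homogeneous_insert m.+1 [::] [::]) super_homogeneous_nil// add0r.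
have -> : m.+1%:Z - 1 = m by lia.
by rewrite IH exprS.
Qed.

End SymmetricSeries.

(** * The determinant along a down-right path *)

(** Pigeonhole: the rows from [k] on outnumber the columns beyond [k], so every permutation meets
    the zero block. *)
Lemma det_zero_block (R : comNzRingType) n (M : 'M[R]_n) (k : 'I_n) :
  (forall a b : 'I_n, (k <= a)%N -> (b <= k)%N -> M a b = 0) -> \det M = 0.
Proof.
move=> M0; rewrite /determinant big1// => s _.
have [a /andP[ka sak]] : exists a : 'I_n, (k <= a)%N && (s a <= k)%N.
  apply/existsP/contraT; rewrite negb_exists => /forallP nexk.
  pose A := [set a : 'I_n | (k <= a)%N]%SET.
  pose B := [set a : 'I_n | (k < a)%N]%SET.
  have: (#|s @: A| <= #|B|)%N.
    apply/subset_leq_card/fintype.subsetP => b /imsetP[a]; rewrite !inE => ka ->.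
    by have := nexk a; rewrite ka /= -ltnNge.
  rewrite card_imset; last exact: perm_inj.
  have -> : A = (k |: B)%SET.
    by apply/setP => a; rewrite !inE leq_eqVlt val_eqE eq_sym.
  by rewrite cardsU1 inE ltnn add1n ltnn.
by rewrite (bigD1 a)//= M0// mul0r mulr0.
Qed.

(** Thresholds are integers because decrements can make them negative. *)
Definition dec (la : nat -> int) (k i : nat) : int :=
  if i == k then la i - 1 else la i.

Lemma dec_same la k : dec la k k = la k - 1.
Proof. by rewrite /dec eqxx. Qed.

Lemma dec_neq la k i : i != k -> dec la k i = la i.
Proof. by rewrite /dec => /negPf ->. Qed.

(* During the step from time [n] to [n.+1], when exactly the particles [i >= j]
   have moved, particle [i] sits at time [stage n j i]. *)
Definition stage (n j i : nat) : nat := n + (j <= i).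

Definition decreasing (l : nat) (la : nat -> int) : Prop :=
  forall i, (i.+1 < l)%N -> la i.+1 <= la i.

Lemma decreasing_le l la i k :
  decreasing l la -> (i <= k < l)%N -> la k <= la i.
Proof.
move=> dla /andP[]; elim: k => [|k IH]; first by rewrite leqn0 => /eqP ->.
rewrite leq_eqVlt => /predU1P[->//|ik] kl.
by apply: le_trans (dla _ kl) _; apply: IH => //; exact: ltnW.
Qed.

Section PathDeterminant.
Variables (R : realType) (l : nat) (p : 'I_l -> R) (x : nat -> R).
Variable nu : l.-tuple nat.
Implicit Types (la : nat -> int).

Lemma x_alphabetS n : x_alphabet x n.+1 = x_alphabet x n ++ [:: x n].
Proof. by rewrite /x_alphabet -addn1 iotaD map_cat. Qed.

Lemma pinv_alphabetS (k : 'I_l) :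
  pinv_alphabet p k.+1 = pinv_alphabet p k ++ [:: (p k)^-1].
Proof.
rewrite /pinv_alphabet.
suff -> : [seq i : 'I_l <- enum 'I_l | (i < k.+1)%N] =
          [seq i : 'I_l <- enum 'I_l | (i < k)%N] ++ [:: k] by rewrite map_cat.
apply: (inj_map val_inj); rewrite map_cat /=.
have E m : [seq \val i | i : 'I_l <- enum 'I_l & (i < m)%N] =
           [seq i <- iota 0 l | (i < m)%N].
  by rewrite -val_enum_ord filter_map.
rewrite !E.
have F m : (m <= l)%N -> [seq i <- iota 0 l | (i < m)%N] = iota 0 m.
  by move=> ml; exact: (filter_iota_ltn 0 ml).
by rewrite !F ?ltn_ord// 1?ltnW// -addn1 iotaD.
Qed.

(** At time 0 this lets a row alphabet cancel against a longer column alphabet; [r] is what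
    remains. *)
Lemma pinv_alphabet_prefix i b : (i <= b <= l)%N ->
  exists2 r, pinv_alphabet p b = pinv_alphabet p i ++ r & size r = (b - i)%N.
Proof.
case/andP; elim: b => [|b IH].
  by rewrite leqn0 => /eqP -> _; exists [::]; rewrite ?cats0.
rewrite leq_eqVlt => /predU1P[->|ib] bl.
  by exists [::]; rewrite ?cats0 ?subnn.
have [r rE rs] := IH ib (ltnW bl).
exists (r ++ [:: (p (Ordinal bl))^-1]).
  by rewrite (pinv_alphabetS (Ordinal bl)) /= rE catA.
by rewrite size_cat rs /=; lia.
Qed.

(** The case [j = l] is the matrix at time [n], the case [j = 0] the one at time [n.+1]. *)
Definition path_matrix (n j : nat) la : 'M[R]_l :=
  \matrix_(i < l, b < l)
    super_homogeneous (la i - (tnth nu b)%:Z + (b : nat)%:Z - (i : nat)%:Z)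
      (x_alphabet x (stage n j i) ++ pinv_alphabet p i.+1) (pinv_alphabet p b).

Definition path_weight (n j : nat) la : R :=
  (\prod_(i < l) p i ^ (la i - (tnth nu i)%:Z))
  * \prod_(i < l) \prod_(k < stage n j i) (1 - p i * x k).

Definition path_det (n j : nat) la : R :=
  path_weight n j la * \det (path_matrix n j la).

(** Passing from [j.+1] to [j] only adds the letter [x n] to row [j], and the determinant is linear
    in that row. *)
Lemma det_path_matrix_step n (j : 'I_l) la :
  \det (path_matrix n j la) =
    \det (path_matrix n j.+1 la) + x n * \det (path_matrix n j (dec la j)).
Proof.
rewrite -[X in X + _]mul1r.
apply: (@determinant_multilinear _ _ _ _ _ j).
- apply/rowP => b; rewrite !mxE mul1r dec_same /stage leqnn ltnn addn1 addn0.
  rewrite x_alphabetS -catA /= super_homogeneous_insert.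
  congr (_ + x n * super_homogeneous _ _ _).
  by lia.
- apply/matrixP => a b; rewrite !mxE.
  congr (super_homogeneous _ (x_alphabet x _ ++ _) _).
  by rewrite /stage; have := neq_lift j a; rewrite -val_eqE /=; lia.
- apply/matrixP => a b; rewrite !mxE dec_neq//.
  by have := neq_lift j a; rewrite -val_eqE /= eq_sym.
Qed.

(** Rows [i] and [i1] have the same degrees and the same x-variables, and row [i1] has the extra
    letter [(p i1)^-1]. Without that letter it is a copy of row [i], which contributes 0. *)
Lemma det_path_matrix_clip n j (i i1 : 'I_l) la :
  (j <= i)%N -> i1 = i.+1 :> nat -> la i1 = la i + 1 ->
  \det (path_matrix n j la) = (p i1)^-1 * \det (path_matrix n j (dec la i1)).
Proof.
move=> ji i1E laE.
pose C := \matrix_(a, b) path_matrix n j la (if a == i1 then i else a) b.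
have C0 : \det C = 0.
  apply: (@determinant_alternate _ _ _ i i1); first by rewrite -val_eqE /=; lia.
  by move=> b; rewrite !mxE eqxx; case: eqP.
rewrite -[RHS]add0r -[X in X + _](mulr0 1) -C0.
apply: (@determinant_multilinear _ _ _ _ _ i1).
- apply/rowP => b; rewrite !mxE mul1r eqxx dec_same.
  have -> : stage n j i1 = stage n j i by rewrite /stage; lia.
  rewrite pinv_alphabetS -i1E catA super_homogeneous_insert cats0.
  congr (super_homogeneous _ _ _ + _ * super_homogeneous _ _ _); lia.
- by apply/matrixP => a b; rewrite !mxE eq_sym (negPf (neq_lift _ _)).
- apply/matrixP => a b; rewrite !mxE dec_neq//.
  by have := neq_lift i1 a; rewrite -val_eqE /= eq_sym.
Qed.

Hypothesis p_neq0 : forall i, p i != 0.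

Lemma path_weight_dec n j la (k : 'I_l) :
  path_weight n j la = p k * path_weight n j (dec la k).
Proof.
rewrite /path_weight mulrA; congr (_ * _).
rewrite (bigD1 k)//= [in RHS](bigD1 k)//= mulrA; congr (_ * _).
  rewrite dec_same -{2}[p k]expr1z -expfzDr//; congr (_ ^ _); lia.
by apply: eq_bigr => i ik; rewrite dec_neq.
Qed.

Lemma path_weight_step n (j : 'I_l) la :
  path_weight n j la = (1 - p j * x n) * path_weight n j.+1 la.
Proof.
rewrite /path_weight mulrCA; congr (_ * _).
rewrite (bigD1 j)//= [in RHS](bigD1 j)//= mulrA; congr (_ * _).
  by rewrite /stage leqnn ltnn addn1 addn0 big_ord_recr /= mulrC.
apply: eq_bigr => i; rewrite -val_eqE /= => ij.
by have -> : stage n j i = stage n j.+1 i by rewrite /stage; lia.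
Qed.

(** The factor [x n] from the determinant joins the factor [p j] that the weight releases under the
    decrement. *)
Lemma path_det_step n (j : 'I_l) la :
  path_det n j la = (1 - p j * x n) * path_det n j.+1 la
                    + p j * x n * path_det n j (dec la j).
Proof.
rewrite /path_det det_path_matrix_step mulrDr {1}path_weight_step.
rewrite (path_weight_dec n j la j) /=; ring.
Qed.

Lemma path_det_clip n j (i i1 : 'I_l) la :
  (j <= i)%N -> i1 = i.+1 :> nat -> la i1 = la i + 1 ->
  path_det n j la = path_det n j (dec la i1).
Proof.
move=> ji i1E laE.
rewrite /path_det (det_path_matrix_clip n ji i1E laE) (path_weight_dec n j la i1).
by rewrite mulrACA divff// mul1r.
Qed.

Hypothesis nu_partition : is_partition nu.

Lemma partition_le (i k : 'I_l) : (i <= k)%N -> (tnth nu k <= tnth nu i)%N.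
Proof.
move=> ik; rewrite !(tnth_nth 0%N).
apply: (@sorted_leq_nth _ geq _ _ 0%N nu) => //; rewrite ?inE ?size_tuple//.
- by move=> a b c /= ab bc; exact: leq_trans bc ab.
- by move=> a; exact: leqnn.
Qed.

(** For rows [a >= k] and columns [b <= k], the chain la_a <= la_k < nu_k <= nu_b makes every degree
    negative. *)
Lemma path_det_notin n j la (k : 'I_l) :
  (forall i : 'I_l, (k <= i)%N -> la i <= la k) ->
  la k < (tnth nu k)%:Z -> path_det n j la = 0.
Proof.
move=> dla lak; rewrite /path_det (det_zero_block (k := k)) ?mulr0// => a b ka bk.
rewrite !mxE super_homogeneous_neg//.
have := dla a ka; have := partition_le bk; lia.
Qed.

Lemma path_det0 la : decreasing l la ->
  path_det 0 l la = ([forall i : 'I_l, (tnth nu i)%:Z <= la i])%:R.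
Proof.
move=> dla; have dla' (i k : 'I_l) : (i <= k)%N -> la k <= la i.
  by move=> ik; apply: (decreasing_le dla); rewrite ik ltn_ord.
have stage0 (i : 'I_l) : stage 0 l i = 0%N by rewrite /stage leqNgt ltn_ord.
case: forallP => [sub|/existsNP[k /negP]]; last first.
  by rewrite -ltNge; exact: path_det_notin (dla' k).
rewrite /path_det det_trig; last first.
  apply/forallP => i; apply/forallP => b; apply/implyP => ib.
  rewrite mxE stage0 /= /x_alphabet /=.
  (* Here [i < b]: cancellation leaves [b - i - 1] denominator letters, while the degree is at least
     [b - i]. *)
  have [|r -> rs] := @pinv_alphabet_prefix i.+1 b; first by rewrite ib ltnW.
  rewrite -{1}[pinv_alphabet p i.+1]cats0 super_homogeneous_cancel.
  rewrite super_homogeneous_nil// rs.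
  have := sub i; have := partition_le (ltnW ib); lia.
rewrite /path_weight [X in _ * X * _]big1; last first.
  by move=> i _; rewrite stage0 big_ord0.
rewrite mulr1 -big_split big1 //= => i _; rewrite mxE stage0 /x_alphabet /=.
(* On the diagonal only the letter [(p i)^-1] survives, and its power cancels the weight. *)
rewrite pinv_alphabetS -{2}[pinv_alphabet p i]cats0 super_homogeneous_cancel.
have := sub i; rewrite -subr_ge0 addrK.
case: (la i - _) => // m _; rewrite super_homogeneous1.
by rewrite -exprnP -exprMn divff// expr1n.
Qed.

End PathDeterminant.

(** * Independence and the particle system *)

Section DiscreteIndependence.
Context {d : measure_display} {T : measurableType d} {R : realType}.
Variable P : probability T R.

(** The preimage of [B] is a countable disjoint union of fibres, numbered through [pickle]. *)
Lemma countable_valued_independent (U : countType) (Z : T -> U) (E : set T) :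
  measurable E -> (forall z, measurable (Z @^-1` [set z])) ->
  (forall z, P (Z @^-1` [set z] `&` E) = (P (Z @^-1` [set z]) * P E)%E) ->
  forall B : set U, measurable (Z @^-1` B) /\
    P (Z @^-1` B `&` E) = (P (Z @^-1` B) * P E)%E.
Proof.
move=> mE mZ iZ B.
pose F k := [set t | pickle (Z t) = k /\ B (Z t)].
have FE k : F k = set0 \/ exists z, F k = Z @^-1` [set z].
  have [[z [zk Bz]]|nz] := pselect (exists z, pickle z = k /\ B z); last first.
    left; apply/seteqP; split=> // t [tk Bt]; apply: nz; by exists (Z t).
  right; exists z; apply/seteqP; split=> t /=.
    by move=> [tk _]; apply: (pcan_inj pickleK); rewrite tk.
  by move=> tz; split; rewrite tz.
have mF k : measurable (F k) by have [->|[z ->]] := FE k.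
have tF : trivIset setT F.
  apply/trivIsetP => a b _ _ ab; apply/seteqP; split=> // t [[ta _] [tb _]].
  by move: ab; rewrite -ta -tb eqxx.
have BE : Z @^-1` B = \bigcup_k F k.
  apply/seteqP; split=> t /=; first by move=> Bt; exists (pickle (Z t)).
  by move=> [k _ []].
split; first by rewrite BE; exact: bigcupT_measurable.
rewrite BE setI_bigcupl !measure_semi_bigcup//.
- rewrite muleC -(fineK (fin_num_measure P E mE)) -nneseriesZl//.
  apply: eq_eseriesr => k _.
  have [->|[z ->]] := FE k; first by rewrite set0I measure0 mule0.
  by apply: (etrans (iZ z)); rewrite muleC fineK// fin_num_measure.
- exact: bigcupT_measurable.
- by move=> k; exact: measurableI.
- exact: trivIset_setIr.
- by apply: bigcupT_measurable => k; exact: measurableI.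
Qed.

(** Splitting by the value [k] of [W] expresses [F m] as a convolution of [F0] with the geometric
    law; for [m > 0] the terms with [k > 0] add up to [q] times the previous value of [F]. *)
Lemma geometric_convolution_step (q : R) (V W : T -> nat) (C : set T) :
  (forall k, measurable (W @^-1` [set k])) ->
  (forall m, measurable (C `&` [set t | (V t <= m)%N])) ->
  (forall m k, P (C `&` [set t | (V t <= m)%N] `&` W @^-1` [set k]) =
     (P (C `&` [set t | (V t <= m)%N]) * ((1 - q) * q ^+ k)%:E)%E) ->
  let F m := fine (P (C `&` [set t | (V t + W t <= m)%N])) in
  let F0 m := fine (P (C `&` [set t | (V t <= m)%N])) in
  F 0%N = (1 - q) * F0 0%N /\
  forall m, F m.+1 = (1 - q) * F0 m.+1 + q * F m.
Proof.
move=> mW mC iC F F0.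
have FE m : F m = \sum_(k < m.+1) (1 - q) * q ^+ k * F0 (m - k)%N.
  have -> : F m = fine (\sum_(k < m.+1) (F0 (m - k)%N * ((1 - q) * q ^+ k))%:E)%E.
    rewrite /F; congr fine.
    have -> : C `&` [set t | (V t + W t <= m)%N] =
       \big[setU/set0]_(k < m.+1)
         (C `&` [set t | (V t <= m - k)%N] `&` W @^-1` [set k : nat]).
      rewrite -(bigcup_mkord _ (fun k =>
         C `&` [set t | (V t <= m - k)%N] `&` W @^-1` [set k])).
      apply/seteqP; split=> t /=.
        by move=> [Ct VW]; exists (W t) => /=; [lia|split=> //; split=> //=; lia].
      by move=> [k /= km [[Ct Vk] Wk]]; split=> //; lia.
    rewrite measure_bigsetU_ord//; last 2 first.
    - by move=> k; exact: measurableI.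
    - apply/trivIsetP => a b _ _ ab; apply/seteqP; split=> // t [[_ ta] [_ tb]].
      by move: ab; rewrite -val_eqE /= -ta -tb eqxx.
    apply: eq_bigr => k _; apply: (etrans (iC _ _)).
    rewrite [RHS]EFinM; congr (_ * _)%E.
    by rewrite fineK// fin_num_measure.
  by rewrite sumEFin /=; apply: eq_bigr => k _; rewrite mulrC.
split=> [|m]; first by rewrite FE big_ord_recl big_ord0 expr0 subnn; ring.
rewrite !FE big_ord_recl expr0 subn0 mulr1; congr (_ + _).
rewrite mulr_sumr; apply: eq_bigr => k _.
rewrite /bump /= subSS exprS; ring.
Qed.

End DiscreteIndependence.

(** * Distribution functions of partially updated configurations *)

Section ParticleSystem.
Context {d : measure_display} {T : measurableType d} {R : realType}.
Variable P : probability T R.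
Variables (l : nat) (p : 'I_l -> R) (x : nat -> R).
Variables (w : 'I_l -> nat -> T -> nat) (G : nat -> T -> l.-tuple nat).
Hypothesis hG : caseA_system P p x w G.
Variable nu : l.-tuple nat.
Implicit Types (la : nat -> int) (s : seq ('I_l * nat)).

(** The values lie in a countable type, so independence of a further jump can be checked on single
    values. *)
Definition history s (t : T) : l.-tuple nat * seq nat :=
  (G 0 t, [seq w o.1 o.2 t | o <- s]).

Lemma history_independent s (j : 'I_l) n k (B : set (l.-tuple nat * seq nat)) :
  uniq s -> (j, n) \notin s ->
  measurable (history s @^-1` B) /\
  P (history s @^-1` B `&` w j n @^-1` [set k]) =
    (P (history s @^-1` B) * P (w j n @^-1` [set k]))%E.
Proof.
move=> us js.
suff main z : measurable (history s @^-1` [set z]) /\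
    P (history s @^-1` [set z] `&` w j n @^-1` [set k]) =
    (P (history s @^-1` [set z]) * P (w j n @^-1` [set k]))%E.
  apply: countable_valued_independent; first exact: caseA_jump_measurable hG _ _ _.
  - by move=> z; have [] := main z.
  - by move=> z; have [] := main z.
case: z => a v; have [sv|/eqP sv] := eqVneq (size v) (size s); last first.
  have -> : history s @^-1` [set (a, v)] = set0.
    by apply/seteqP; split=> // t [_ tv]; apply: sv; rewrite -tv size_map.
  by rewrite set0I measure0 mul0e; split.
(* The event [history s = (a, v)] prescribes one value per index of the independent family; index
   [(j, n)] gets [k]. *)
pose A o := match o with
  | None => G 0 @^-1` [set a]
  | Some o => w o.1 o.2 @^-1`
      [set if o == (j, n) then k else nth 0%N v (index o s)]
  end.
have mA o : measurable (A o).
  case: o => [u|]; first exact: caseA_jump_measurable hG _ _ _.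
  exact: caseA_init_measurable hG _.
have AE o : caseA_events w G o (A o).
  case: o => [[i m]|] /=; first by exists [set if (i, m) == (j, n) then k
    else nth 0%N v (index (i, m) s)].
  by exists [set a].
have HE : history s @^-1` [set (a, v)] =
    \bigcap_(o in [set` None :: map Some s]) A o.
  apply/seteqP; split=> t.
    move=> [ta tv]; case=> [u|] //=; rewrite inE /= mem_map; last by move=> ? ? [].
    move=> us'; case: eqP => [uj|_]; first by rewrite -uj us' in js.
    by rewrite -tv (nth_map u) ?nth_index// index_mem.
  move=> At; have ta : G 0 t = a by apply: (At None); rewrite /= inE.
  rewrite /history /= ta; congr pair; apply: (@eq_from_nth _ 0%N).
    by rewrite size_map.
  rewrite size_map => i i_s.
  have [u0 _] : exists o : 'I_l * nat, o \in s.
    by case: (s) i_s => // o ? _; exists o; rewrite mem_head.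
  rewrite (nth_map u0)//; set o := nth u0 s i.
  have os : o \in s by exact: mem_nth.
  have := At (Some o); rewrite /= inE /= mem_map; last by move=> ? ? [].
  move=> /(_ os) ->; rewrite index_uniq//.
  by case: eqP => // oj; rewrite -oj os in js.
have WE : w j n @^-1` [set k] = A (Some (j, n)) by rewrite /= eqxx.
split; first by rewrite HE bigcap_seq; exact: bigsetI_measurable.
have uN : uniq (None :: map Some s).
  rewrite /= map_inj_uniq ?us ?andbT; last by move=> ? ? [].
  by apply/mapP => -[].
rewrite muleC WE HE setIC.
have -> : A (Some (j, n)) `&` \bigcap_(o in [set` None :: map Some s]) A o =
   \bigcap_(o in [set` Some (j, n) :: None :: map Some s]) A o.
  by rewrite !bigcap_seq [in RHS]big_cons.
have ind := caseA_independent hG.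
(* The product formula is applied twice, with and without the index [(j, n)]. *)
rewrite !ind//; first by rewrite [LHS]big_cons.
by rewrite cons_uniq uN andbT inE /= mem_map.
Qed.

(** Pushes only go towards lower labels, hence an induction starting from the last particle. *)
Lemma step_determined n a t t' : G n t = G n t' ->
  (forall i : 'I_l, (a <= i)%N -> w i n t = w i n t') ->
  forall i, (a <= i)%N -> nth 0%N (G n.+1 t) i = nth 0%N (G n.+1 t') i.
Proof.
move=> Gn wn i.
move: {2}(l - i)%N (leqnn (l - i)) => e.
elim: e i => [|e IH] i le ai; first by rewrite !nth_default ?size_tuple//; lia.
have [li|il] := leqP l i; first by rewrite !nth_default ?size_tuple.
have := caseA_step hG n t (Ordinal il); have := caseA_step hG n t' (Ordinal il).
rewrite !(tnth_nth 0%N) /= => -> ->.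
by rewrite Gn (IH i.+1) ?wn//; lia.
Qed.

Lemma path_determined n t t' : G 0 t = G 0 t' ->
  (forall (i : 'I_l) k, (k < n)%N -> w i k t = w i k t') -> G n t = G n t'.
Proof.
move=> G0; elim: n => // n IH wn.
apply/val_inj/(@eq_from_nth _ 0%N) => [|i _]; first by rewrite !size_tuple.
apply: (@step_determined _ 0%N) => //; last by move=> k _; exact: wn.
by apply: IH => k m mn; apply: wn; exact: ltnW.
Qed.

Definition path_event (n j : nat) la : set T :=
  [set t | G 0 t = nu /\ forall i : 'I_l, (tnth (G (stage n j i) t) i)%:Z <= la i].

(** This is not yet divided by the probability of starting at [nu]. *)
Definition path_prob n j la : R := fine (P (path_event n j la)).

Lemma path_prob_lt0 n j la (i : 'I_l) : la i < 0 -> path_prob n j la = 0.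
Proof.
move=> lai; rewrite /path_prob (_ : path_event _ _ _ = set0) ?measure0//.
by apply/seteqP; split=> // t [_ /(_ i)]; lia.
Qed.

(** Both particles have moved, and pushing keeps particle [i1] weakly below particle [i], so the
    threshold of [i] bounds both. *)
Lemma path_prob_clip n j (i i1 : 'I_l) la :
  (j <= i)%N -> i1 = i.+1 :> nat -> la i1 = la i + 1 ->
  path_prob n j la = path_prob n j (dec la i1).
Proof.
move=> ji i1E laE; rewrite /path_prob; congr (fine (P _)).
apply/seteqP; split=> t [t0 Gla]; split=> // k.
  have [->|ki1] := eqVneq k i1; last by rewrite dec_neq.
  rewrite dec_same; have := Gla i; rewrite /stage i1E ji leqW// !addn1.
  have := caseA_step hG n t i; rewrite -i1E -(tnth_nth 0%N).
  lia.
by have := Gla k; rewrite /dec; case: eqP => //; lia.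
Qed.

Lemma path_prob_step n (j : 'I_l) la :
  (forall i1 : 'I_l, i1 = j.+1 :> nat -> la i1 <= la j) ->
  path_prob n j la = (1 - p j * x n) * path_prob n j.+1 la
                     + p j * x n * path_prob n j (dec la j).
Proof.
move=> laj; have [laj0|] := ltP (la j) 0.
  rewrite !(@path_prob_lt0 _ _ _ j)// ?mulr0 ?addr0//.
  by rewrite dec_same; lia.
(* [V] is the site from which particle [j] jumps; [C] collects the conditions on the start and on
   the other particles. *)
pose V t := maxn (tnth (G n t) j) (nth 0%N (G n.+1 t) j.+1).
pose C := [set t | G 0 t = nu /\ forall i : 'I_l, i != j ->
  (tnth (G (stage n j i) t) i)%:Z <= la i].
pose s := undup [seq o <- [seq (i, k) | i <- enum 'I_l, k <- iota 0 n.+1]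
                | o != (j, n)].
have sP (i : 'I_l) k : (k <= n)%N -> (i, k) != (j, n) -> (i, k) \in s.
  move=> kn ijn; rewrite mem_undup mem_filter ijn andTb.
  by apply: allpairs_f; rewrite ?mem_enum// mem_iota; lia.
have us : uniq s by exact: undup_uniq.
have js : (j, n) \notin s by rewrite mem_undup mem_filter eqxx.
have stageE (i : 'I_l) : i != j -> stage n j i = if (j < i)%N then n.+1 else n.
  by rewrite -val_eqE /= /stage; case: ltnP; lia.
(* The event is determined by the start and the jumps up to this step other than [w j n], so it is
   independent of [w j n]. *)
have CE m : C `&` [set t | (V t <= m)%N] = history s @^-1`
    (history s @` (C `&` [set t | (V t <= m)%N])).
  apply/seteqP; split=> t; first by move=> Ct; exists t.
  move=> [t' [[t'0 t'C] t'V] [Gtt' wtt']].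
  have ww (i : 'I_l) k : (k <= n)%N -> (i, k) != (j, n) -> w i k t' = w i k t.
    by move=> kn ijn; have /eq_in_map/(_ _ (sP i k kn ijn)) := wtt'.
  have Gn : G n t' = G n t.
    apply: path_determined => // i k kn; apply: ww; first exact: ltnW.
    by rewrite xpair_eqE negb_and; apply/orP; right; lia.
  have GS i : (j < i)%N -> nth 0%N (G n.+1 t') i = nth 0%N (G n.+1 t) i.
    apply: step_determined => // k jk; apply: ww => //.
    by rewrite xpair_eqE negb_and -val_eqE /=; apply/orP; left; lia.
  split; last by move: t'V; rewrite /V /= Gn GS.
  split; first by rewrite -Gtt'.
  move=> i ij; have := t'C i ij; rewrite stageE//; case: ltnP => [ji|_].
    by rewrite !(tnth_nth 0%N) GS.
  by rewrite Gn.
have [mC iC] : (forall m, measurable (C `&` [set t | (V t <= m)%N])) /\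
    forall m k, P (C `&` [set t | (V t <= m)%N] `&` w j n @^-1` [set k]) =
     (P (C `&` [set t | (V t <= m)%N])
      * ((1 - p j * x n) * (p j * x n) ^+ k)%:E)%E.
  split=> [m|m k]; rewrite CE.
    by have [] := @history_independent s j n 0%N
      (history s @` (C `&` [set t | (V t <= m)%N])) us js.
  have [_ ->] := @history_independent s j n k
      (history s @` (C `&` [set t | (V t <= m)%N])) us js.
  by rewrite (caseA_jump_law hG).
have mW k : measurable (w j n @^-1` [set k]) := caseA_jump_measurable hG j n k.
have [F0 FS] := geometric_convolution_step mW mC iC.
have jE t : tnth (G n.+1 t) j = (V t + w j n t)%N by exact: caseA_step hG _ _ _.
have splitE (mu : nat -> int) m : mu j = Posz m ->
    (forall i : 'I_l, i != j -> mu i = la i) ->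
    path_event n j mu = C `&` [set t | (V t + w j n t <= m)%N].
  move=> muj mula; apply/seteqP; split=> t.
    move=> [t0 tmu]; split; first split=> // i ij.
      by rewrite -mula.
    by have := tmu j; rewrite /stage leqnn addn1 jE muj /=; lia.
  move=> [[t0 tC] tV]; split=> // i.
  have [->|ij] := eqVneq i j; last by rewrite mula// tC.
  by rewrite /stage leqnn addn1 jE muj; move: tV => /=; lia.
case laE : (la j) => [m|//] _.
(* Within [C] particle [j.+1], if there is one, is at most [la j = m], so [V <= m] only constrains
   particle [j] at time [n]. *)
have -> : path_prob n j.+1 la = fine (P (C `&` [set t | (V t <= m)%N])).
  rewrite /path_prob; congr (fine (P _)).
  have stE (i : 'I_l) : i != j -> stage n j.+1 i = stage n j i.
    by rewrite -val_eqE /= /stage; lia.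
  apply/seteqP; split=> t.
    move=> [t0 tla]; split; first by split=> // i ij; rewrite -stE.
    rewrite /= /V geq_max; apply/andP; split.
      by have := tla j; rewrite /stage ltnn addn0 laE.
    have [jl|lj] := ltnP j.+1 l; last by rewrite nth_default ?size_tuple.
    have := tla (Ordinal jl); rewrite /stage /= ltnS leqnn addn1.
    rewrite (tnth_nth 0%N) /=.
    by have := laj (Ordinal jl) erefl; rewrite laE /=; lia.
  move=> [[t0 tC] /=]; rewrite /V geq_max => /andP[Gj _]; split=> // i.
  have [->|ij] := eqVneq i j; last by rewrite stE// tC.
  by rewrite /stage ltnn addn0 laE.
rewrite {1}/path_prob (splitE la m)//.
case: m laE => [|m] laE.
  (* For [m = 0] the decremented threshold is -1 and its event is empty. *)
  rewrite F0 (@path_prob_lt0 _ _ (dec la j) j) ?mulr0 ?addr0//.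
  by rewrite dec_same laE.
rewrite FS /path_prob (splitE (dec la j) m)//; first by rewrite dec_same laE; lia.
by move=> i ij; rewrite dec_neq.
Qed.

Lemma path_prob0 la : path_prob 0 l la =
  fine (P [set t | G 0 t = nu]) * ([forall i : 'I_l, (tnth nu i)%:Z <= la i])%:R.
Proof.
have stage0 (i : 'I_l) : stage 0 l i = 0%N by rewrite /stage leqNgt ltn_ord.
rewrite /path_prob; case: forallP => [sub|nsub].
  rewrite mulr1; congr (fine (P _)).
  apply/seteqP; split=> t; first by case.
  by move=> /= t0; split=> // i; rewrite stage0 t0.
rewrite mulr0 (_ : path_event _ _ _ = set0) ?measure0//.
apply/seteqP; split=> // t [t0 tla]; apply: nsub => i.
by rewrite -t0; have := tla i; rewrite stage0.
Qed.

(** * Equality of distribution function and determinant along the updates *)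

Hypothesis p_neq0 : forall i, p i != 0.
Hypothesis nu_partition : is_partition nu.

Let c := fine (P [set t | G 0 t = nu]).

Definition agree n j := forall la, decreasing l la ->
  path_prob n j la = c * path_det p x nu n j la.

Lemma agree0 : agree 0 l.
Proof. by move=> la dla; rewrite path_prob0 path_det0. Qed.

Lemma sum_dec la (k : 'I_l) :
  \sum_(r < l) (dec la k r + 1) = \sum_(r < l) (la r + 1) - 1.
Proof.
rewrite (bigD1 k)//= [in RHS](bigD1 k)//= dec_same.
rewrite (eq_bigr (fun r : 'I_l => la r + 1)); first by ring.
by move=> r rk; rewrite dec_neq.
Qed.

(* Decrementing entry [j] may break monotonicity by one at position [j]; clipping
   repairs it there and moves the defect to the right, so a single defect [i]
   has to be tracked, and the sum of the entries decreases all along. *)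
Lemma agree_step n (j : 'I_l) : agree n j.+1 -> agree n j.
Proof.
move=> agS.
(* The defect at [i] is an increase by at most one. The shift by 1 in the sum makes all terms
   nonnegative once the last threshold is. *)
suff main N : forall la (i : nat), (j <= i)%N ->
    (\sum_(r < l) (la r + 1) < N%:Z) ->
    (forall r, (r.+1 < l)%N -> la r.+1 <= la r + (r == i)%:Z) ->
    path_prob n j la = c * path_det p x nu n j la.
  move=> la dla.
  apply: (main `|\sum_(r < l) (la r + 1)|.+1 la j) => //; first by lia.
  by move=> r rl; have := dla r rl; lia.
have lP : (l.-1 < l)%N by have := ltn_ord j; lia.
(* Both sides vanish: positions are nonnegative, and the last row of the matrix is zero. *)
have last_lt0 la : la l.-1 < 0 -> path_prob n j la = c * path_det p x nu n j la.
  move=> la0; rewrite (@path_prob_lt0 _ _ _ (Ordinal lP))//.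
  rewrite (@path_det_notin _ _ _ _ _ _ _ _ _ (Ordinal lP))// ?mulr0//=.
  - move=> r lr; have -> : r = Ordinal lP; last by [].
    by apply/val_inj => /=; have := ltn_ord r; lia.
  - by lia.
elim: N => [|N IH] la i ji sumla dla;
  have [/last_lt0//|last_ge0] := ltP (la l.-1) 0.
(* Walking left from the last entry, every threshold is at least -1, so the sum cannot be
   negative. *)
- suff : 0 <= \sum_(r < l) (la r + 1) by lia.
  suff ge e : (e < l)%N -> 0 <= la (l.-1 - e)%N + (l.-1 - e <= i)%:Z.
    apply: sumr_ge0 => r _.
    have := ge (l.-1 - r)%N; rewrite subKn; last by have := ltn_ord r; lia.
    by have := ltn_ord r; lia.
  elim: e => [|e IHe] el; first by rewrite subn0; lia.
  have := IHe (ltnW el); have := dla (l.-1 - e.+1)%N.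
  have -> : (l.-1 - e.+1).+1 = (l.-1 - e)%N by lia.
  by lia.
(* An actual defect is clipped and its position moves to [i.+1]; otherwise [la] is decreasing and
   the recursion for particle [j] applies. *)
have [/andP[il /eqP laE]|ndef] :=
    boolP ((i.+1 < l)%N && (la i.+1 == la i + 1)).
  pose i0 := Ordinal (ltnW il); pose i1 := Ordinal il.
  rewrite (@path_prob_clip n j i0 i1)// (@path_det_clip _ _ _ _ _ _ n j i0 i1)//.
  apply: (IH _ i.+1); first exact: leqW.
    by rewrite sum_dec; lia.
  move=> r rl; have := dla r rl; rewrite /dec /=.
  by have [->|] := eqVneq r i; rewrite ?laE; do !case: eqP => ?; lia.
have dec_la : decreasing l la.
  move=> r rl; have := dla r rl.
  have [ri|] := eqVneq r i; last by rewrite addr0.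
  by move: ndef; rewrite -ri rl /=; lia.
rewrite path_prob_step; last first.
  by move=> i1 i1E; have := dec_la j; rewrite -i1E; apply; exact: ltn_ord.
rewrite path_det_step// agS// (IH (dec la j) j)//.
- by ring.
- by rewrite sum_dec; lia.
- by move=> r rl; have := dec_la r rl; rewrite /dec; do !case: eqP => ?; lia.
Qed.

(** A time step updates the particles from the last to the first; after it, stage [0] at time [n] is
    stage [l] at time [n.+1]. *)
Lemma agree_all n : agree n l.
Proof.
elim: n => [|n IH]; first exact: agree0.
have agj e : (e <= l)%N -> agree n (l - e).
  elim: e => [|e IHe] el; first by rewrite subn0.
  have jl : (l - e.+1 < l)%N by lia.
  apply: (@agree_step n (Ordinal jl)) => /=.
  have -> : (l - e.+1).+1 = (l - e)%N by lia.
  exact: IHe (ltnW el).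
have stE (i : 'I_l) : stage n.+1 l i = stage n 0 i.
  by rewrite /stage leqNgt ltn_ord /= addn0 addn1.
move=> la dla; have := agj l (leqnn l) la dla; rewrite subnn.
have -> : path_prob n 0 la = path_prob n.+1 l la.
  rewrite /path_prob; congr (fine (P _)).
  by apply/seteqP; split=> t [t0 tla]; split=> // i; have := tla i; rewrite stE.
move=> ->; rewrite /path_det /path_weight; congr (_ * (_ * _)).
  by congr (_ * _); apply: eq_bigr => i _; rewrite stE.
by congr determinant; apply/matrixP => i b; rewrite !mxE stE.
Qed.

End ParticleSystem.

Theorem theorem6p3 (d : measure_display) (T : measurableType d) (R : realType)
    (P : probability T R) (l : nat) (p : 'I_l -> R) (x : nat -> R)
    (w : 'I_l -> nat -> T -> nat) (G : nat -> T -> l.-tuple nat)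
    (n : nat) (la nu : l.-tuple nat)
    (hpx : forall (j : 'I_l) (i : nat), 0 < p j * x i < 1)
    (hG : caseA_system P p x w G)
    (hla : is_partition la) (hnu : is_partition nu)
    (hP : (0 < P [set t | G 0%N t = nu])%E) :
  prob_le P G n la nu =
    pi_skew p la nu
    * (\prod_(i < l) \prod_(j < n) (1 - p i * x j))
    * \det (caseA_matrix p x n la nu).
Proof.
have p_neq0 i : p i != 0.
  by apply/eqP => p0; have := hpx i 0%N; rewrite p0 mul0r ltxx.
pose mu i : int := Posz (nth 0%N la i).
have dmu : decreasing l mu.
  move=> i il; rewrite lez_nat.
  have := partition_le hla (i := Ordinal (ltnW il)) (k := Ordinal il) (leqnSn i).
  by rewrite !(tnth_nth 0%N).
have muE (i : 'I_l) : mu i = (tnth la i)%:Z by rewrite (tnth_nth 0%N).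
have stE (i : 'I_l) : stage n l i = n by rewrite /stage leqNgt ltn_ord addn0.
have c_neq0 : fine (P [set t | G 0 t = nu]) != 0.
  rewrite gt_eqF// fine_gt0// hP /= ltey_eq.
  by rewrite fin_num_measure//; exact: caseA_init_measurable hG nu.
have := @agree_all _ _ _ _ _ _ _ _ _ hG _ p_neq0 hnu n mu dmu.
have -> : path_prob P G nu n l mu = fine (P
    ([set t | forall j : 'I_l, (tnth (G n t) j <= tnth la j)%N]
     `&` [set t | G 0%N t = nu])).
  rewrite /path_prob; congr (fine (P _)); apply/seteqP; split=> t /=.
    by move=> [t0 tla]; split=> // i; have := tla i; rewrite stE muE.
  by move=> [tla t0]; split=> // i; rewrite stE muE; exact: tla.
rewrite /prob_le /cond_prob => ->.
(* Conditioning divides by the probability of the start, which cancels the factor carried so far. *)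
rewrite mulrAC divff// mul1r /path_det /path_weight.
congr (_ * _ * _).
- by apply: eq_bigr => i _; rewrite muE.
- by apply: eq_bigr => i _; rewrite stE.
- by congr determinant; apply/matrixP => i b; rewrite !mxE stE muE.
Qed.
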